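(* Let $n,m\ge 1$ and let $S_1,\dots,S_m\in\mathbf{AdS}$ be (not necessarily distinct) admissible subsets of $[n,\bar n]$. Let $P=\Delta^0_{S_1}+\cdots+\Delta^0_{S_m}\subset\mathbb{R}^n$ (Minkowski sum). Then $$\big|(P-\square_{[n]})\cap\mathbb{Z}^n\big|=\sum_{T\in\mathbf{AdS}_n}\big|\mathrm{D}(P_T)\cap\square_{[m]}\big|.$$
   Context: Let $[n]=\{1,\dots,n\}$, $[\bar n]=\{\bar1,\dots,\bar n\}$, $[n,\bar n]=[n]\sqcup[\bar n]$. Let $\mathbf{e}_1,\dots,\mathbf{e}_n$ be the standard basis of $\mathbb{R}^n$ and $\mathbf{e}_{\bar i}:=-\mathbf{e}_i$. Admissible subsets: $\mathbf{AdS}$ is the set of nonempty $S\subset[n,\bar n]$ such that $\{i,\bar i\}\not\subset S$ for all $i\in[n]$; $\mathbf{AdS}_n:=\{S\in\mathbf{AdS}: |S|=n\}$. For an admissible (or empty) set $S$, $\Delta^0_S:=\mathrm{conv}(\{\mathbf 0\}\cup\{\mathbf{e}_i: i\in S\})$, so $\Delta^0_\emptyset=\{\mathbf 0\}$. $\square_{[n]}=\sum_{i\in[n]}\Delta^0_{\{i\}}=[0,1]^n$. Minkowski difference: $P-Q:=\{\mathbf{x}\in\mathbb{R}^n:\mathbf{x}+Q\subseteq P\}$. For $T\in\mathbf{AdS}_n$, $P_T:=\Delta^0_{S_1\cap T}+\cdots+\Delta^0_{S_m\cap T}$. The set $\mathrm{D}(P_T)$ of $G$-draconian sequences of $P_T$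 is the set of sequences $(a_1,\dots,a_m)$ of nonnegative integers with $a_1+\cdots+a_m=n$ and $\sum_{i\in I}a_i\le\big|\bigcup_{i\in I}(S_i\cap T)\big|$ for every nonempty $I\subseteq[m]$. $\mathrm{D}(P_T)\cap\square_{[m]}$ denotes the set of those sequences in $\mathrm{D}(P_T)$ with $a_i\le1$ for all $i\in[m]$. *)

(* Defs.v *)
From HB Require Import structures.
From mathcomp Require Import all_boot all_order all_algebra finmap.
From mathcomp Require Import boolp classical_sets functions cardinality reals.
From mathcomp Require Import convex.

Set Implicit Arguments.
Unset Strict Implicit.
Unset Printing Implicit Defensive.

Import Order.TTheory GRing.Theory Num.Theory.

Local Open Scope classical_set_scope.
Local Open Scope ring_scope.

(* [n, nbar] as a disjoint union: inl i stands for i, inr i for its bar. *)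
Notation signed n := ('I_n + 'I_n)%type.

Definition admissible n (S : {set signed n}) : bool :=
  (S != finset.set0) && [forall i, ~~ ((inl i \in S) && (inr i \in S))].

Definition AdS_top n : {set {set signed n}} :=
  [set S : {set signed n} | admissible S && (#|S| == n)]%SET.

Definition evec (R : realType) n (s : signed n) : 'rV[R]_n :=
  match s with
  | inl i => delta_mx 0 i
  | inr i => - delta_mx 0 i
  end.

Definition conv_hull (R : realType) (V : lmodType R) (A : set V) : set V :=
  smallest (@convex_set R V) A.

Definition simplex0 (R : realType) n (S : {set signed n}) : set 'rV[R]_n :=
  conv_hull ([set 0] `|` [set evec R s | s in [set s | s \in S]]).
Arguments simplex0 R {n} S.

Definition minkowski_sum (V : nmodType) m (A : 'I_m -> set V) : set V :=
  [set \sum_(i < m) y i | y in [set y : 'I_m -> V | forall i, A i (y i)]].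

Definition minkowski_diff (V : nmodType) (P Q : set V) : set V :=
  [set x | [set x + q | q in Q] `<=` P].

Definition cube (R : realType) n : set 'rV[R]_n :=
  minkowski_sum (fun i : 'I_n => simplex0 R [set inl i]%SET).
Arguments cube : clear implicits.

Definition lattice (R : realType) n : set 'rV[R]_n :=
  [set x | forall i, x 0 i \is a Num.int].
Arguments lattice : clear implicits.

(* G-draconian sequences of the sum of the simplices simplex0 R (U i); they
   depend only on the family of index sets U, not on the polytope itself. *)
Definition draconian n m (U : 'I_m -> {set signed n}) :
    set {ffun 'I_m -> nat} :=
  [set a | (\sum_(i < m) a i = n)%N /\
    forall I : {set 'I_m}, I != finset.set0 ->
      (\sum_(i in I) a i <= #|(\bigcup_(i in I) U i)%SET|)%N].

Definition le1_seq m : set {ffun 'I_m -> nat} :=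
  [set a | forall i, (a i <= 1)%N].
Arguments le1_seq : clear implicits.

(* fset_set is the empty set on infinite sets; this rules that case out. *)
Lemma finite_draconian_le1 n m (U : 'I_m -> {set signed n}) :
  finite_set (draconian U `&` le1_seq m).
Proof.
pose f (b : {ffun 'I_m -> 'I_2}) := [ffun i => b i : nat].
apply: (@sub_finite_set _ _ (f @` setT)); last first.
  by apply: finite_image; exact: finite_finset.
move=> a [_ a1]; exists [ffun i => inord (a i)] => //.
by apply/ffunP => i; rewrite !ffunE inordK// ltnS a1.
Qed.

(* Main.v *)
Require Import Defs.
From mathcomp Require Import all_boot all_order all_algebra zify.

Set Implicit Arguments.
Unset Strict Implicit.
Unset Printing Implicit Defensive.

(** Cutting along the orthants turns both sides of the identity into counts on
    bipartite graphs.  A sum of simplices [Delta^0_S] with admissible [S] is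
    closed under moving a coordinate towards 0, and its part in the orthant of
    [T] is the polymatroid of the vectors [y >= 0] whose sum over each
    [B <= T] is at most the number of [i] such that [S_i] meets [B].  A unit
    cube with integral corner [x] lies in a single orthant [T], and it lies in
    the polytope as soon as its corner farthest from the origin does.  The
    absolute values of the coordinates of that corner form a vector of positive
    integers on [T], and [x] is recovered from it.  So the lattice points are
    the pairs of some [T] and a positive integral vector on [T] which satisfies
    Hall's inequalities ([minkowski_diff_cube_lattice]; the realisation of such
    a vector by points of the simplices is Hall's theorem,
    [hall_assignment]).  On the other side, a draconian 0/1 sequence for [T] is
    the indicator of a set [J] of [n] indices that can be matched perfectly
    to [T] ([draconian_hall_sets]).

    It remains to see that, in a bipartite graph between [X] and [Y], the
    positive vectors on [Y] satisfying Hall's inequalities are as many as the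
    subsets of [X] that can be matched perfectly to [Y]
    ([card_hall_vectors_hall_sets]).  Write [N(X, Y)] for either number.  In
    both cases the objects are pairs of a set of left vertices and a weight on
    the right vertices, constrained by
    [g(B) = number of neighbours of B - weight of B >= 0]; in the first case
    the set is fixed and the weight varies, in the second the weight is
    constantly 1 and the set varies.  The function [g] is submodular, so if it
    is at least -1, the sets where it equals -1 have a least element [A], and
    the object splits into a critical object on [A] and an object satisfying
    Hall's inequalities on [Y \ A], for the graph without the neighbours of [A]
    ([deficient_sum]).  Writing [E] for the number of critical objects and
    [M(X, Y, U)] for the number of objects such that [g < 0] somewhere but
    [g >= -1] everywhere, with [g >= 0] on the sets that do not meet [U] (in the
    second case, sets with one element less than [Y]), one gets for both kinds
    of objects
    - [N(l + X, Y) = N(X, Y) + M(X, Y, S l)],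
    - [M(X, Y, U) =
         sum over A meeting U of E(X, A) * N(X \ neighbours of A, Y \ A)],
    - [N(X, Y \ r) = M(X, Y, {r})] for [r] in [Y].
    The last two determine [E(X, Y)] from values at smaller right sides, and the
    first two then determine [N(X, Y)] by induction on [X]. *)

(** * Hall's inequalities and their least violation *)

Section Hall.
Local Open Scope set_scope.
Local Open Scope nat_scope.

Variables (L R : finType) (S : L -> {set R}).
Implicit Types (X J : {set L}) (w : R -> nat) (Y A B C : {set R}).

Lemma set1_meets (T : finType) (x : T) (B : {set T}) :
  ([set x] :&: B != set0) = (x \in B).
Proof.
by apply/set0Pn/idP => [[r]|rB];
  [rewrite !inE => /andP[/eqP->]|exists x; rewrite !inE eqxx].
Qed.

Definition nbrs B : {set L} := [set l | S l :&: B != set0].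

Definition hall X w Y : bool :=
  [forall B : {set R}, (B \subset Y) ==> (\sum_(r in B) w r <= #|X :&: nbrs B|)].

(** Hall's inequalities after a new left vertex with neighbourhood [U] has been
    added to [X], see [hall_setU1]. *)
Definition near_hall X w Y U : bool :=
  [forall B : {set R}, (B \subset Y) ==>
     (\sum_(r in B) w r <= #|X :&: nbrs B| + (U :&: B != set0))].

Definition deficient X w Y U : bool := near_hall X w Y U && ~~ hall X w Y.

Definition critical X w A : bool :=
  (\sum_(r in A) w r == #|X :&: nbrs A|.+1) &&
  [forall B : {set R}, (B \proper A) ==> (\sum_(r in B) w r <= #|X :&: nbrs B|)].

Lemma hallP X w Y : reflect
  (forall B, B \subset Y -> \sum_(r in B) w r <= #|X :&: nbrs B|) (hall X w Y).
Proof. by apply: (iffP forallP) => h B; [apply: implyP|apply/implyP]; apply: h. Qed.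

Lemma near_hallP X w Y U : reflect
  (forall B, B \subset Y ->
     \sum_(r in B) w r <= #|X :&: nbrs B| + (U :&: B != set0)) (near_hall X w Y U).
Proof. by apply: (iffP forallP) => h B; [apply: implyP|apply/implyP]; apply: h. Qed.

Lemma criticalP X w A : reflect
  (\sum_(r in A) w r = #|X :&: nbrs A|.+1 /\
   forall B, B \proper A -> \sum_(r in B) w r <= #|X :&: nbrs B|)
  (critical X w A).
Proof.
apply: (iffP andP) => -[/eqP h1 h2]; split=> //.
  by move=> B; apply/implyP; move/forallP: h2; apply.
by apply/forallP => B; apply/implyP; exact: h2.
Qed.

Lemma nbrsU A B : nbrs (A :|: B) = nbrs A :|: nbrs B.
Proof. by apply/setP => l; rewrite !inE setIUr setU_eq0 negb_and. Qed.

Lemma nbrsS A B : A \subset B -> nbrs A \subset nbrs B.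
Proof. by move=> /setUidPr <-; rewrite nbrsU subsetUl. Qed.

(** The coverage function is submodular; all uncrossing arguments rest on it. *)
Lemma card_nbrs_submod X A B :
  #|X :&: nbrs (A :|: B)| + #|X :&: nbrs (A :&: B)|
    <= #|X :&: nbrs A| + #|X :&: nbrs B|.
Proof.
rewrite nbrsU setIUr -(cardsUI (X :&: nbrs A)) leq_add2l subset_leq_card//.
rewrite -setIIr setIS// subsetI.
by rewrite !nbrsS ?subsetIl ?subsetIr.
Qed.

Lemma sum_setUI w A B :
  \sum_(r in A :|: B) w r + \sum_(r in A :&: B) w r
    = \sum_(r in A) w r + \sum_(r in B) w r.
Proof.
rewrite (big_setID A)/= setUK setDUl setDv set0U.
rewrite addnAC -addnA; congr addn; rewrite [RHS](big_setID A)/= addnC.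
by rewrite addnC (setIC B).
Qed.

Lemma sum_setU_disjoint w A C : [disjoint A & C] ->
  \sum_(r in A :|: C) w r = \sum_(r in A) w r + \sum_(r in C) w r.
Proof.
by move=> /disjoint_setI0 dAC; rewrite -sum_setUI dAC big_set0 addn0.
Qed.

(** Contracting [A]: past [A], only the vertices with no neighbour in [A]
    contribute. *)
Lemma card_nbrsU X A C :
  #|X :&: nbrs (A :|: C)| = #|X :&: nbrs A| + #|(X :\: nbrs A) :&: nbrs C|.
Proof.
rewrite nbrsU -(cardsID (nbrs A)); congr addn; apply: eq_card => l; rewrite !inE;
  by case: (l \in X); case: (_ == _); case: (_ == _).
Qed.

(** A violating set of minimal cardinality is critical.  Its excess is exactly 1,
    so what the other sets may still use beyond it is Hall's condition for the
    contraction. *)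
Lemma deficient_critical X w Y U : deficient X w Y U ->
  exists A, [/\ A \subset Y, U :&: A != set0, critical X w A
              & hall (X :\: nbrs A) w (Y :\: A)].
Proof.
case/andP => /near_hallP q; rewrite negb_forall => /existsP[B0].
rewrite negb_imply -ltnNge => hB0.
pose viol B := (B \subset Y) && (#|X :&: nbrs B| < \sum_(r in B) w r).
have [A /andP[AY vA] Amin] := @arg_minnP _ B0 viol (fun B => #|B|) hB0.
have UA : U :&: A != set0.
  by apply/negP => /eqP U0; move: (q _ AY); rewrite U0 eqxx addn0 leqNgt vA.
have eA : \sum_(r in A) w r = #|X :&: nbrs A|.+1.
  by have := q _ AY; rewrite UA; lia.
exists A; split=> //.
  apply/criticalP; split=> // B BA; rewrite leqNgt; apply/negP => vB.
  have /Amin : viol B by rewrite /viol vB (subset_trans (proper_sub BA)).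
  by rewrite leqNgt proper_card.
apply/hallP => C; rewrite subsetD => /andP[CY CA].
have := q (A :|: C); rewrite subUset AY CY => /(_ isT).
rewrite sum_setU_disjoint 1?disjoint_sym// card_nbrsU; case: (_ != _); lia.
Qed.

(** By submodularity, the slack of [B] is at least that of [A :&: B] plus the one
    of [B :\: A] in the contraction.  It can thus be negative only when [B]
    contains [A], and then [B] meets [U] because [A] does. *)
Lemma critical_deficient X w Y U A : A \subset Y -> U :&: A != set0 ->
  critical X w A -> hall (X :\: nbrs A) w (Y :\: A) -> deficient X w Y U.
Proof.
move=> AY UA /criticalP[eA cA] /hallP h; apply/andP; split; last first.
  by apply/negP => /hallP/(_ _ AY); rewrite eA ltnn.
apply/near_hallP => B BY.
have := h (B :\: A) (setSD _ BY).
have := card_nbrsU X A (B :\: A); have := @sum_setU_disjoint w A (B :\: A).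
have -> : A :|: B :\: A = A :|: B.
  by apply/setP => r; rewrite !inE; case: (r \in A).
rewrite disjoints_subset setCD subsetUr => /(_ isT).
have := card_nbrs_submod X A B; have := sum_setUI w A B.
have [/eqP AB|AB] := boolP (A :&: B == A).
  rewrite AB.
  have -> : U :&: B != set0.
    by apply: contraNneq UA => U0; rewrite -subset0 -U0 setIS// -AB subsetIr.
  lia.
have := cA (A :&: B); rewrite properEneq AB subsetIl => /(_ isT).
lia.
Qed.

(** If the intersection were proper in [A], it would not be violated, and the
    union would then be violated by 2. *)
Lemma critical_least X w Y A A' : A \subset Y -> A' \subset Y ->
  critical X w A -> hall (X :\: nbrs A) w (Y :\: A) ->
  critical X w A' -> A \subset A'.
Proof.
move=> AY AY' cA h cA'.
have [/criticalP[eA pA] /criticalP[eA' _]] := (cA, cA').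
(* With U = A, [critical_deficient] bounds every violation on Y by 1. *)
have A0 : A :&: A != set0.
  rewrite setIid; apply/eqP => A0; move: eA; rewrite A0 big_set0; lia.
have /andP[/near_hallP q _] := critical_deficient AY A0 cA h.
apply/setIidPl/eqP; apply: contraT => AB.
have := pA (A :&: A'); rewrite properEneq AB subsetIl => /(_ isT).
have := q (A :|: A'); rewrite subUset AY AY' => /(_ isT).
have := card_nbrs_submod X A A'; have := sum_setUI w A A'.
case: (_ != _); lia.
Qed.

(** The decomposition in additive form: the critical set is unique, so the sum has
    at most one nonzero term. *)
Lemma deficient_sum X w Y U :
  (deficient X w Y U : nat) =
  \sum_(A : {set R} | (A \subset Y) && (U :&: A != set0))
    (critical X w A && hall (X :\: nbrs A) w (Y :\: A)).
Proof.
case: (boolP (deficient _ _ _ _)) => [/deficient_critical[A [AY UA cA hA]]|ns].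
  rewrite (bigD1 A) ?AY//= cA hA big1// => B /andP[/andP[BY _] BA].
  apply/eqP; rewrite eqb0; apply: contra BA => /andP[cB hB].
  by rewrite eqEsubset (critical_least BY AY cB hB cA) (critical_least AY BY cA hA cB).
rewrite big1// => A /andP[AY UA]; apply/eqP; rewrite eqb0.
by apply: contra ns => /andP[]; exact: critical_deficient.
Qed.

Lemma card_setU1_nbrs l X B : l \notin X ->
  #|(l |: X) :&: nbrs B| = #|X :&: nbrs B| + (S l :&: B != set0).
Proof.
move=> lX; case: (boolP (S l :&: B != set0)) => SB.
  have -> : (l |: X) :&: nbrs B = l |: (X :&: nbrs B).
    by apply/setP => k; rewrite !inE; case: eqVneq => // ->; rewrite SB.
  by rewrite cardsU1 !inE (negbTE lX) addnC.
rewrite addn0; apply: eq_card => k; rewrite !inE.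
by case: eqVneq => // ->; rewrite (negbTE SB) !andbF.
Qed.

Lemma hall_setU1 l X w Y : l \notin X -> hall (l |: X) w Y = near_hall X w Y (S l).
Proof.
by move=> lX; apply/hallP/near_hallP => h B /h; rewrite card_setU1_nbrs.
Qed.

Lemma hall_near_hall X w Y U : hall X w Y -> near_hall X w Y U.
Proof.
by move=> /hallP h; apply/near_hallP => B /h/leq_trans; apply; exact: leq_addr.
Qed.

Lemma hall_split l X w Y : l \notin X ->
  (hall (l |: X) w Y : nat) = hall X w Y + deficient X w Y (S l).
Proof.
move=> lX; rewrite hall_setU1// /deficient.
by have := @hall_near_hall X w Y (S l); case: hall; case: near_hall => // /(_ isT).
Qed.

Lemma eq_hall X w w' Y : {in Y, w =1 w'} -> hall X w Y = hall X w' Y.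
Proof.
move=> e; apply/hallP/hallP => h B BY; move: (h _ BY); congr (_ <= _);
by apply: eq_bigr => r /(subsetP BY)/e.
Qed.

Lemma eq_critical X w w' A : {in A, w =1 w'} -> critical X w A = critical X w' A.
Proof.
move=> e; rewrite /critical (eq_bigr _ e); congr andb; apply: eq_forallb => B.
case: (boolP (B \proper A)) => //= /proper_sub BA; congr (_ <= _).
by apply: eq_bigr => r /(subsetP BA)/e.
Qed.

(** * The two families of objects and their recurrences *)

(** The bound on the entries only makes the type finite: Hall's inequality on a
    singleton gives at most [#|L|], and a deficient vector exceeds it by at most
    1. *)
Local Notation demand := {ffun R -> 'I_(#|L|.+2)}.
Implicit Types (z : demand).

Definition wt z : R -> nat := fun r => z r.
Definition supp z : {set R} := [set r | 0 < wt z r].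
Definition ones : R -> nat := fun=> 1.

(** Entries must be positive on [Y] and vanish elsewhere; asking for the support
    to be exactly [Y] says both. *)
Definition hall_vectors X Y := [set z | (supp z == Y) && hall X (wt z) Y].
Definition deficient_vectors X Y U := [set z | (supp z == Y) && deficient X (wt z) Y U].
Definition critical_vectors X A := [set z | (supp z == A) && critical X (wt z) A].
(** When [#|J| = #|Y|], Hall's inequalities for the constant weight 1 say that [J]
    can be matched perfectly to [Y]. *)
Definition hall_sets X Y : {set {set L}} := 
  [set J : {set L} | (J \subset X) && (#|J| == #|Y|) && hall J ones Y].
Definition deficient_sets X Y U : {set {set L}} :=
  [set J : {set L} | (J \subset X) && (#|J|.+1 == #|Y|) && deficient J ones Y U].
(** Restricting to neighbours of [A] makes the splitting of a deficient set [J]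
    into a critical part and a remainder unique; criticality then forces
    [#|J| = #|A| - 1]. *)
Definition critical_sets X A : {set {set L}} :=
  [set J : {set L} | (J \subset X :&: nbrs A) && critical J ones A].

Lemma critical_nbrs X w A : critical X w A = critical (X :&: nbrs A) w A.
Proof.
have e B : B \subset A -> X :&: nbrs A :&: nbrs B = X :&: nbrs B.
  by move=> BA; rewrite -setIA; congr (_ :&: _); apply/setIidPr/nbrsS.
rewrite /critical e//; congr andb; apply: eq_forallb => B.
by case: (boolP (B \proper A)) => //= /proper_sub BA; rewrite e.
Qed.

(** Stated for an arbitrary family of pairs (set, weight), so that it serves the
    vectors, where the set is constant, and the sets, where the weight is. *)
Lemma card_deficient_sum (O : finType) (P : pred O) (X : O -> {set L})
    (w : O -> R -> nat) Y U :
  #|[set o | P o && deficient (X o) (w o) Y U]| =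
  \sum_(A : {set R} | (A \subset Y) && (U :&: A != set0))
    #|[set o | P o && (critical (X o) (w o) A
                      && hall (X o :\: nbrs A) (w o) (Y :\: A))]|.
Proof.
have card_ind (Q : pred O) : #|[set o | Q o]| = \sum_o Q o.
  by rewrite -sum1dep_card big_mkcond; apply: eq_bigr => o _; case: (Q o).
rewrite card_ind; under [RHS]eq_bigr do rewrite card_ind.
rewrite exchange_big; apply: eq_bigr => o _.
case: (P o) => /=; last by rewrite big1.
exact: deficient_sum.
Qed.

(** A deficient vector is glued from its restrictions to [A] and to [Y :\: A]. *)
Lemma card_deficient_vectors X Y U :
  #|deficient_vectors X Y U| =
  \sum_(A : {set R} | (A \subset Y) && (U :&: A != set0))
    #|critical_vectors X A| * #|hall_vectors (X :\: nbrs A) (Y :\: A)|.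
Proof.
rewrite (card_deficient_sum _ (fun=> X)); apply: eq_bigr => A /andP[AY _].
pose glue (p : demand * demand) : demand :=
  [ffun r => if r \in A then p.1 r else p.2 r].
have glueA p : {in A, wt (glue p) =1 wt p.1}.
  by move=> r rA; rewrite /wt ffunE rA.
have glueC p : {in Y :\: A, wt (glue p) =1 wt p.2}.
  by move=> r; rewrite inE => /andP[rA _]; rewrite /wt ffunE (negbTE rA).
rewrite -cardsX -(@card_in_imset _ _ glue); last first.
  move=> [p q] [p' q']; rewrite !inE /=.
  move=> /andP[/andP[/eqP sp _] /andP[/eqP sq _]].
  move=> /andP[/andP[/eqP sp' _] /andP[/eqP sq' _]] /ffunP e.
  have out (u v : demand) r : supp u = supp v -> r \notin supp u -> u r = v r.
    move=> euv ru; have := ru; rewrite euv; move: ru; rewrite !inE /wt => ru rv.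
    by apply: val_inj => /=; move: ru rv; rewrite -!eqn0Ngt => /eqP -> /eqP ->.
  congr (_, _); apply/ffunP => r; have := e r; rewrite !ffunE /=.
    by case: ifP => // rA _; apply: out; rewrite sp ?sp' ?rA.
  case: ifP => // rA _; apply: out; first by rewrite sq sq'.
  by rewrite sq inE rA.
apply: eq_card => z; rewrite inE; apply/idP/imsetP.
  case/and3P => /eqP sz cz hz.
  pose p : demand := [ffun r => if r \in A then z r else ord0].
  pose q : demand := [ffun r => if r \in A then ord0 else z r].
  have gz : glue (p, q) = z by apply/ffunP => r; rewrite !ffunE /=; case: (r \in A).
  exists (p, q) => //.
  have eA := eq_critical X (glueA (p, q)); rewrite gz cz /= in eA.
  have eC := eq_hall (X :\: nbrs A) (glueC (p, q)); rewrite gz hz /= in eC.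
  rewrite inE /= !inE -eA -eC !andbT.
  apply/andP; split; apply/eqP/setP => r.
    rewrite inE /wt ffunE; case: ifP => // rA.
    by move: (subsetP AY _ rA); rewrite -sz inE.
  by rewrite !inE /wt ffunE -sz inE /wt; case: ifP.
move=> [[p q]]; rewrite !inE /= => /andP[/andP[/eqP sp cp] /andP[/eqP sq hq]] ->.
rewrite (eq_critical _ (glueA (p, q))) cp.
rewrite (eq_hall _ (glueC (p, q))) hq !andbT; apply/eqP/setP => r.
rewrite inE /wt ffunE /=; case: ifP => rA.
  by rewrite (subsetP AY _ rA); move: rA; rewrite -sp inE.
by move/setP/(_ r): sq; rewrite !inE rA.
Qed.

(** A deficient set is the disjoint union of its part inside [nbrs A] and its part
    outside; the sizes fit since the critical part has [#|A| - 1] elements. *)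
Lemma card_deficient_sets X Y U :
  #|deficient_sets X Y U| =
  \sum_(A : {set R} | (A \subset Y) && (U :&: A != set0))
    #|critical_sets X A| * #|hall_sets (X :\: nbrs A) (Y :\: A)|.
Proof.
rewrite (card_deficient_sum _ id (fun=> ones)); apply: eq_bigr => A /andP[AY _].
pose glue (p : {set L} * {set L}) := p.1 :|: p.2.
have split X1 X2 : X1 \subset X :&: nbrs A -> X2 \subset X :\: nbrs A ->
    (X1 :|: X2) :&: nbrs A = X1 /\ (X1 :|: X2) :\: nbrs A = X2.
  rewrite subsetI subsetD => /andP[_ h1] /andP[_ h2].
  rewrite setIUl setDUl (setIidPl h1) (setDidPl h2) (disjoint_setI0 h2) setU0.
  by move: h1; rewrite -setD_eq0 => /eqP ->; rewrite set0U.
rewrite -cardsX -(@card_in_imset _ _ glue); last first.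
  move=> [p q] [p' q']; rewrite !inE /=.
  move=> /andP[/andP[sp _] /andP[/andP[sq _] _]].
  move=> /andP[/andP[sp' _] /andP[/andP[sq' _] _]].
  have [e1 e2] := split _ _ sp sq; have [e1' e2'] := split _ _ sp' sq'.
  by rewrite /glue /= => e; move: e1 e2; rewrite e e1' e2' => -> ->.
have cY : #|Y| = #|A| + #|Y :\: A|.
  by rewrite -(cardsID A Y) (setIidPr AY).
apply: eq_card => J; rewrite inE; apply/idP/imsetP.
  case/and3P => /andP[JX /eqP cJ] cr hJ.
  exists (J :&: nbrs A, J :\: nbrs A); last by rewrite /glue /= setID.
  rewrite inE /= !inE setSI//= setSD//= -critical_nbrs cr hJ !andbT.
  move/criticalP: cr => [+ _]; rewrite /ones sum1_card.
  by have := cardsID (nbrs A) J; lia.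
move=> [[p q]]; rewrite !inE /= => /andP[/andP[sp cp] /andP[/andP[sq /eqP eq] hq]] ->.
rewrite /glue /=; have [e1 e2] := split _ _ sp sq.
rewrite critical_nbrs e1 cp e2 hq !andbT; apply/andP; split.
  rewrite subUset (subset_trans sp) ?subsetIl//.
  by rewrite (subset_trans sq) ?subsetDl.
rewrite -(cardsID (nbrs A)) e1 e2; move/criticalP: cp => [+ _].
rewrite /ones sum1_card (setIidPl _); first lia.
by apply: subset_trans sp _; rewrite subsetIr.
Qed.

Lemma card_hall_vectors_setU1 l X Y : l \notin X ->
  #|hall_vectors (l |: X) Y| =
    #|hall_vectors X Y| + #|deficient_vectors X Y (S l)|.
Proof.
move=> lX; rewrite -cardsUI.
have -> : hall_vectors X Y :&: deficient_vectors X Y (S l) = set0.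
  apply/setP => z; rewrite !inE /deficient; case: (hall _ _ _); rewrite ?andbF//.
rewrite cards0 addn0; apply: eq_card => z; rewrite !inE -andb_orr.
congr andb; have := @hall_split l X (wt z) Y lX.
by case: hall; case: hall; case: deficient.
Qed.

(** The sets without [l] are those of [X].  Removing [l] from the others leaves one
    element too few, so Hall's inequality fails on [Y] itself. *)
Lemma card_hall_sets_setU1 l X Y : l \notin X ->
  #|hall_sets (l |: X) Y| =
    #|hall_sets X Y| + #|deficient_sets X Y (S l)|.
Proof.
move=> lX; rewrite -(cardsID [set J : {set L} | l \notin J]); congr addn.
  apply: eq_card => J; rewrite !inE; case: (boolP (l \in J)) => lJ /=; last first.
    by rewrite andbT -subDset (setDidPl _)// disjoint_sym disjoints1.
  rewrite andbF; apply/esym/negP => /andP[/andP[/subsetP/(_ _ lJ)]].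
  by rewrite (negbTE lX).
rewrite -(@card_in_imset _ _ (fun J => l |: J) (mem (deficient_sets X Y (S l))));
  last first.
  move=> J J'; rewrite !inE => /andP[/andP[JX _] _] /andP[/andP[JX' _] _] e.
  have nl (K : {set L}) : K \subset X -> (l |: K) :\ l = K.
    by move=> KX; apply: setU1K; apply: contra lX => /(subsetP KX).
  by rewrite -(nl _ JX) e nl.
apply: eq_card => J; rewrite !inE negbK; apply/idP/imsetP.
  case/and3P => lJ /andP[sJ /eqP cJ] hJ; exists (J :\ l); last by rewrite setD1K.
  have lJ' : l \notin J :\ l by rewrite !inE eqxx.
  have cJ' : #|J| = #|J :\ l|.+1 by rewrite (cardsD1 l) lJ.
  rewrite !inE subDset sJ -cJ' cJ eqxx /=.
  rewrite -[J in hall J _ _](setD1K lJ) hall_setU1// in hJ.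
  rewrite /deficient hJ /=; apply/negP => /hallP/(_ _ (subxx Y)).
  rewrite /ones sum1_card -cJ cJ' => /leq_trans/(_ (subset_leq_card (subsetIl _ _))).
  by rewrite ltnn.
move=> [J']; rewrite inE => /andP[/andP[sJ /eqP cJ] /andP[qJ _]] ->.
have lJ : l \notin J' by apply: contra lX => /(subsetP sJ).
by rewrite !inE eqxx /= setUS//= cardsU1 lJ -cJ eqxx hall_setU1.
Qed.

(** Both sides ask for [#|Y| - 1] elements, and the inequalities for sets through
    [r0] follow, up to 1, from those without [r0]. *)
Lemma hall_sets_setD1 r0 X Y : r0 \in Y ->
  hall_sets X (Y :\ r0) = deficient_sets X Y [set r0].
Proof.
move=> rY; apply/setP => J; rewrite !inE [in RHS](cardsD1 r0) rY add1n eqSS.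
case: eqP => [cJ|]; rewrite ?andbT ?andbF//; case: (J \subset X) => //=.
apply/hallP/andP => [h|[/near_hallP h _] B].
  split.
    apply/near_hallP => B BY.
    rewrite set1_meets /ones sum1_card (cardsD1 r0 B) addnC leq_add2r.
    have := h (B :\ r0) (setSD _ BY); rewrite /ones sum1_card => /leq_trans; apply.
    by rewrite subset_leq_card// setIS// nbrsS// subsetDl.
  apply/negP => /hallP/(_ _ (subxx Y)).
  rewrite /ones sum1_card => /leq_trans/(_ (subset_leq_card (subsetIl _ _))).
  by rewrite cJ (cardsD1 r0 Y) rY ltnn.
rewrite subsetD1 => /andP[BY rB].
by have := h B BY; rewrite set1_meets (negbTE rB) addn0.
Qed.

Definition upd z r0 (t : 'I_(#|L|.+2)) : demand :=
  [ffun r => if r == r0 then t else z r].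

Lemma upd_id z r0 : upd z r0 (z r0) = z.
Proof. by apply/ffunP => r; rewrite ffunE; case: eqP => // ->. Qed.

Lemma upd_upd z r0 t t' : upd (upd z r0 t) r0 t' = upd z r0 t'.
Proof. by apply/ffunP => r; rewrite !ffunE; case: eqP. Qed.

Lemma sum_upd z r0 t B :
  \sum_(r in B) wt (upd z r0 t) r =
  \sum_(r in B :\ r0) wt z r + (r0 \in B) * t.
Proof.
have e : \sum_(r in B :\ r0) wt (upd z r0 t) r = \sum_(r in B :\ r0) wt z r.
  by apply: eq_bigr => r; rewrite !inE /wt ffunE => /andP[/negbTE ->].
case: (boolP (r0 \in B)) => rB; last first.
  rewrite -e addn0; apply: eq_bigl => r; rewrite !inE.
  by case: eqP => // ->; exact/negbTE.
by rewrite (big_setD1 r0)//= e addnC mul1n /wt ffunE eqxx.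
Qed.

Lemma supp_upd z r0 t :
  supp (upd z r0 t) = if 0 < t then r0 |: supp z else supp z :\ r0.
Proof.
apply/setP => r; case: ltnP => t0; rewrite !inE /wt ffunE; case: eqP => //= _.
by apply/negbTE; rewrite -leqNgt.
Qed.

(** Forgetting the entry at [r0] is a bijection.  Given the other entries, the
    vectors that violate Hall's inequalities by exactly 1, and only on sets
    through [r0], are those whose entry at [r0] is one more than the largest
    entry compatible with the inequalities. *)
Lemma card_hall_vectors_setD1 r0 X Y : r0 \in Y ->
  #|hall_vectors X (Y :\ r0)| = #|deficient_vectors X Y [set r0]|.
Proof.
move=> rY.
have zero_inj :
    {in deficient_vectors X Y [set r0] &, injective (fun z => upd z r0 ord0)}.
  (* If t < t' and t' violates by at most 1, then t does not violate. *)
  have H z (t t' : 'I_(#|L|.+2)) : t <= t' ->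
      upd z r0 t \in deficient_vectors X Y [set r0] ->
      upd z r0 t' \in deficient_vectors X Y [set r0] -> t = t'.
    rewrite leq_eqVlt => /orP[/eqP/val_inj//|tt'].
    rewrite !inE => /and3P[_ _ nh] /and3P[_ /near_hallP q _]; case/negP: nh.
    apply/hallP => B BY; have := q B BY; rewrite !sum_upd set1_meets.
    case: (_ \in _); lia.
  move=> z z' zS z'S e; rewrite -(upd_id z r0) -(upd_id z' r0).
  have ez t : upd z r0 t = upd z' r0 t.
    by have := congr1 (fun u => upd u r0 t) e; rewrite !upd_upd.
  rewrite ez; congr upd; rewrite -(upd_id z r0) ez in zS; rewrite -(upd_id z' r0) in z'S.
  case: (leqP (z r0) (z' r0)) => [|/ltnW] le.
    exact: (H z').
  exact/esym/(H z').
rewrite -(card_in_imset zero_inj); apply: eq_card => z0; apply/idP/imsetP; last first.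
  move=> [z]; rewrite !inE => /and3P[/eqP sz /near_hallP q _] ->.
  rewrite supp_upd /= sz eqxx /=; apply/hallP => B; rewrite subsetD1 => /andP[BY rB].
  have := q B BY; rewrite -{1}(upd_id z r0) !sum_upd set1_meets (negbTE rB).
  by rewrite !mul0n !addn0.
rewrite inE => /andP[/eqP sz /hallP h].
have z0r : z0 r0 = ord0.
  apply: val_inj => /=; move/setP/(_ r0): sz; rewrite !inE eqxx /wt /=.
  by case: (nat_of_ord (z0 r0)).
(* The room left at r0 by the inequality for B. *)
pose g B := #|X :&: nbrs B| - \sum_(r in B :\ r0) wt z0 r.
have hg B : B \subset Y -> \sum_(r in B :\ r0) wt z0 r + g B = #|X :&: nbrs B|.
  move=> BY; rewrite /g subnKC//; apply: leq_trans (h _ (setSD _ BY)) _.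
  by rewrite subset_leq_card// setIS// nbrsS// subsetDl.
pose P B := (r0 \in B) && (B \subset Y).
have PY : P Y by rewrite /P rY subxx.
have [B0 /andP[rB0 BY0] Bmin] := @arg_minnP _ Y P g PY.
have ltg : (g B0).+1 < #|L|.+2.
  rewrite !ltnS; apply: leq_trans (max_card (mem (X :&: nbrs B0))).
  by rewrite /g leq_subr.
exists (upd z0 r0 (Ordinal ltg)); last by rewrite upd_upd -z0r upd_id.
rewrite inE supp_upd /= sz setD1K// eqxx /=; apply/andP; split.
  apply/near_hallP => B BY; rewrite sum_upd set1_meets /=.
  have := hg B BY; case: (boolP (r0 \in B)) => rB.
    have : g B0 <= g B by apply: Bmin; rewrite /P rB.
    lia.
  lia.
apply/negP => /hallP/(_ _ BY0); rewrite sum_upd rB0 /=.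
have := hg _ BY0; lia.
Qed.

Lemma supp_eq0 z : \sum_(r in supp z) wt z r = 0 -> supp z = set0.
Proof.
move=> /eqP; rewrite sum_nat_eq0 => /forallP s0; apply/setP => r; rewrite in_set0.
by apply/negP => rs; move: (s0 r); rewrite rs /=; move: rs; rewrite inE; lia.
Qed.

Lemma card_hall_vectors_Y0 X : #|hall_vectors X set0| = 1.
Proof.
apply/eqP/cards1P; exists [ffun=> ord0]; apply/setP => z; rewrite !inE.
apply/andP/eqP => [[/eqP sz _]|->].
  apply/ffunP => r; rewrite ffunE; apply: val_inj => /=.
  by move/setP/(_ r): sz; rewrite !inE /wt; case: (nat_of_ord (z r)).
split; first by apply/eqP/setP => r; rewrite !inE /wt ffunE.
by apply/hallP => B _; rewrite big1// => r _; rewrite /wt ffunE.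
Qed.

Lemma card_hall_sets_Y0 X : #|hall_sets X set0| = 1.
Proof.
apply/eqP/cards1P; exists set0; apply/setP => J; rewrite !inE cards0 cards_eq0.
case: eqP => [->|]; rewrite ?andbF// sub0set /=.
by apply/hallP => B; rewrite subset0 => /eqP->; rewrite big_set0.
Qed.

Lemma card_hall_vectors_X0 Y : Y != set0 -> #|hall_vectors set0 Y| = 0.
Proof.
move=> Y0; apply/eqP; rewrite cards_eq0 -subset0; apply/subsetP => z.
rewrite !inE => /andP[/eqP sz /hallP/(_ _ (subxx _))].
by rewrite set0I cards0 leqn0 -sz => /eqP/supp_eq0; rewrite sz => e; rewrite e eqxx in Y0.
Qed.

Lemma card_hall_sets_X0 Y : Y != set0 -> #|hall_sets set0 Y| = 0.
Proof.
move=> Y0; apply/eqP; rewrite cards_eq0 -subset0; apply/subsetP => J.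
rewrite !inE subset0 => /andP[/andP[/eqP-> ]].
by rewrite cards0 eq_sym cards_eq0 (negbTE Y0).
Qed.

Lemma properDn0 A Y : A \subset Y -> A != set0 -> Y :\: A \proper Y.
Proof.
move=> AY /set0Pn[r rA]; rewrite properE subsetDl; apply/negP => h.
by move: (subsetP h _ (subsetP AY _ rA)); rewrite inE rA.
Qed.

(** Both families obey the same recurrences.  In the third one, at the right side
    [Y] and a chosen [r0] in [Y], the term for [A = Y] is the number of critical
    objects on [Y] and all other terms live on proper subsets of [Y]; this settles
    the critical objects.  The first recurrence then settles the others by
    induction on [X]. *)
Theorem card_hall_vectors_hall_sets X Y : #|hall_vectors X Y| = #|hall_sets X Y|.
Proof.
suff: (forall X, #|hall_vectors X Y| = #|hall_sets X Y|) /\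
      (Y != set0 -> forall X, #|critical_vectors X Y| = #|critical_sets X Y|) by case.
have [k] := ubnP #|Y|; elim: k => // k IH in X Y *; rewrite ltnS => Yk.
have IHp A B : A \proper Y -> B \proper Y -> A != set0 -> forall X',
    #|critical_vectors X' A| * #|hall_vectors (X' :\: nbrs A) B| =
    #|critical_sets X' A| * #|hall_sets (X' :\: nbrs A) B|.
  move=> /proper_card AY /proper_card BY A0 X'.
  have [_ ->//] := IH X' A (leq_trans AY Yk).
  by have [->] := IH X' B (leq_trans BY Yk).
have [->|Y0] := eqVneq Y set0.
  by split=> // X'; rewrite card_hall_vectors_Y0 card_hall_sets_Y0.
have cr X' : #|critical_vectors X' Y| = #|critical_sets X' Y|.
  have /set0Pn[r0 rY] := Y0.
  have Yr : #|Y :\ r0| < k by rewrite (cardsD1 r0) rY in Yk.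
  have [/(_ X') e _] := IH X' _ Yr; move: e.
  rewrite card_hall_vectors_setD1// hall_sets_setD1// card_deficient_vectors card_deficient_sets.
  have PY : (Y \subset Y) && ([set r0] :&: Y != set0) by rewrite subxx set1_meets.
  rewrite !(bigD1 Y PY)/= setDv card_hall_vectors_Y0 card_hall_sets_Y0 !muln1.
  rewrite [X in _ + X](eq_bigr (fun A =>
    #|critical_sets X' A| * #|hall_sets (X' :\: nbrs A) (Y :\: A)|)).
    by move/addIn.
  move=> A /andP[/andP[AY rA] nAY]; rewrite set1_meets in rA.
  apply: IHp; first by rewrite properEneq nAY.
    by apply: properDn0 => //; apply/set0Pn; exists r0.
  by apply/set0Pn; exists r0.
split=> // X'.
have [j] := ubnP #|X'|; elim: j => // j IHX in X' *; rewrite ltnS => Xj.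
have [->|/set0Pn[l lX]] := eqVneq X' set0.
  by rewrite card_hall_vectors_X0 ?card_hall_sets_X0.
rewrite -(setD1K lX) card_hall_vectors_setU1 ?card_hall_sets_setU1 ?inE ?eqxx//.
rewrite IHX; last by rewrite (cardsD1 l) lX in Xj.
congr addn; rewrite card_deficient_vectors card_deficient_sets; apply: eq_bigr => A /andP[AY SA].
have [->|nAY] := eqVneq A Y.
  by rewrite setDv card_hall_vectors_Y0 card_hall_sets_Y0 cr.
have A0 : A != set0 by apply: contraNneq SA => ->; rewrite setI0.
apply: IHp => //; first by rewrite properEneq nAY.
exact: properDn0.
Qed.

(** Hall's theorem with multiplicities, by removing a left vertex [l].  If the
    inequalities fail without [l], the least violated set meets [S l], and
    assigning [l] to a common element lowers the weight of every violated set. *)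
Lemma hall_assignment X (w : R -> nat) Y : hall X w Y ->
  exists phi : L -> option R,
    (forall l r, phi l = Some r -> l \in X /\ r \in S l) /\
    (forall r, r \in Y -> #|[set l | phi l == Some r]| = w r).
Proof.
have [k] := ubnP #|X|; elim: k => // k IH in X w *; rewrite ltnS => Xk.
have [->|/set0Pn[l lX]] := eqVneq X set0.
  move=> /hallP h; exists (fun=> None); split=> // r rY.
  have := h [set r]; rewrite sub1set rY => /(_ isT).
  by rewrite set0I cards0 big_set1 leqn0 => /eqP ->.
have Xl : #|X :\ l| < k by rewrite (cardsD1 l) lX in Xk.
rewrite -{1}(setD1K lX) hall_setU1 ?inE ?eqxx// => q.
case: (boolP (hall (X :\ l) w Y)) => [/(IH _ _ Xl)[phi [p1 p2]]|nh].
  by exists phi; split=> // k' r /p1[]; rewrite inE => /andP[].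
have /deficient_critical[A [AY /set0Pn[s]]] : deficient (X :\ l) w Y (S l).
  by rewrite /deficient q.
rewrite inE => /andP[sl sA] cA hA.
have ws : 0 < w s.
  rewrite lt0n; apply/negP => /eqP ws; move/criticalP: cA => [eA /(_ (A :\ s))].
  rewrite properD1// => /(_ isT); rewrite leqNgt => /negP[].
  have -> : \sum_(r in A :\ s) w r = \sum_(r in A) w r by rewrite (big_setD1 s sA)/= ws.
  by rewrite eA ltnS subset_leq_card// setIS// nbrsS// subsetDl.
have sAU : [set s] :&: A != set0 by rewrite set1_meets.
have /andP[/near_hallP q' _] := critical_deficient AY sAU cA hA.
have /(IH _ _ Xl)[phi [p1 p2]] : hall (X :\ l) (fun r => w r - (r == s)) Y.
  apply/hallP => B BY; have := q' B BY; rewrite set1_meets.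
  have e : \sum_(r in B :\ s) (w r - (r == s)) = \sum_(r in B :\ s) w r.
    by apply: eq_bigr => r; rewrite !inE => /andP[/negbTE -> _]; rewrite subn0.
  case: (boolP (s \in B)) => sB; rewrite ?addn0 ?addn1.
    rewrite !(big_setD1 s sB)/= e eqxx.
    by case: (w s) ws => // v _; rewrite addSn ltnS subn1.
  suff -> : \sum_(r in B) (w r - (r == s)) = \sum_(r in B) w r by [].
  apply: eq_bigr => r rB; rewrite (_ : (r == s) = false) ?subn0//.
  by apply: contraNF sB => /eqP <-.
have phil : phi l = None.
  by case e: (phi l) => [r|//]; have [] := p1 _ _ e; rewrite !inE eqxx.
exists (fun k' => if k' == l then Some s else phi k'); split=> [k' r|r rY].
  case: eqP => [-> [<-]//|_ /p1[]]; by rewrite inE => /andP[].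
have [->|rs] := eqVneq r s.
  have sY := subsetP AY _ sA.
  have := p2 _ sY; rewrite eqxx /= => ps; rewrite -(subnK ws) -ps addn1.
  rewrite (cardsD1 l) inE eqxx eqxx add1n; congr _.+1.
  by apply: eq_card => k'; rewrite !inE; have [->|kl] := eqVneq k' l; rewrite ?phil.
have := p2 _ rY; rewrite (negbTE rs) subn0 => <-.
apply: eq_card => k'; rewrite !inE; have [->|//] := eqVneq k' l.
by rewrite phil; apply/negbTE; apply: contra rs => /eqP[->].
Qed.

End Hall.

(** * Sums of simplices *)

From mathcomp Require Import finmap.
From mathcomp Require Import boolp classical_sets functions cardinality reals.
From mathcomp Require Import convex interval_inference lra.

Import Order.TTheory GRing.Theory Num.Theory.

Local Open Scope classical_set_scope.
Local Open Scope ring_scope.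

Lemma card_eq_finset (T : finType) (G : {set T}) : ([set` G] #= `I_#|G|)%card.
Proof.
have -> : [set` G] = [set` [fset x in G]%fset].
  by apply/seteqP; split=> x; rewrite /= inE.
by apply/card_eq_fsetP; rewrite card_imfset//= cardE.
Qed.

Section Hull.
Variables (R : realType) (V : lmodType R).

Lemma conv_hull_sub (A C : set V) :
  (forall x y (t : R), 0 <= t <= 1 -> C x -> C y -> C (t *: x + (1 - t) *: y)) ->
  A `<=` C -> conv_hull A `<=` C.
Proof.
move=> cC AC; apply: smallest_sub => // x y t /set_mem Cx /set_mem Cy.
by apply/mem_set/cC => //; rewrite ge0 le1.
Qed.

Lemma sub_conv_hull (A : set V) : A `<=` conv_hull A.
Proof. exact: sub_smallest. Qed.

Lemma conv_hull_scale (A : set V) (v : V) (c : R) :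
  A 0 -> A v -> 0 <= c <= 1 -> conv_hull A (c *: v).
Proof.
move=> A0 Av /andP[c0 c1] B [cB AB].
have /(_ (Itv01 c0 c1)) := cB v 0 _ (mem_set (AB _ Av)) (mem_set (AB _ A0)).
by move=> /set_mem; rewrite /conv/= scaler0 addr0.
Qed.

End Hull.

Section Polytope.
Variables (R : realType) (n : nat).
Implicit Types (U : {set signed n}) (x y q : 'rV[R]_n) (s : signed n).

Definition signed_coord x s : R :=
  match s with inl k => x 0 k | inr k => - x 0 k end.

Lemma signed_coord0 s : signed_coord 0 s = 0.
Proof. by case: s => k; rewrite /= mxE ?oppr0. Qed.

Lemma signed_coordD x y s :
  signed_coord (x + y) s = signed_coord x s + signed_coord y s.
Proof. by case: s => k; rewrite /= mxE ?opprD. Qed.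

Lemma signed_coordZ c x s : signed_coord (c *: x) s = c * signed_coord x s.
Proof. by case: s => k; rewrite /= mxE ?mulrN. Qed.

Lemma signed_coord_sum m (y : 'I_m -> 'rV[R]_n) s :
  signed_coord (\sum_(i < m) y i) s = \sum_(i < m) signed_coord (y i) s.
Proof. by case: s => k; rewrite /= summxE ?sumrN. Qed.

Lemma signed_coord_evec_le s s' : signed_coord (evec R s) s' <= (s == s')%:R.
Proof.
case: s s' => [j|j] [k|k]; rewrite /= !mxE eqxx/= ?opprK;
  rewrite ?(inj_eq inl_inj) ?(inj_eq inr_inj) (eq_sym k) //.
  by rewrite oppr_le0 ler0n.
by rewrite oppr_le0 ler0n.
Qed.

(** The left side is linear in [y], so it suffices to check the vertices. *)
Lemma simplex0_sum_le U (B : {set signed n}) y : simplex0 R U y ->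
  \sum_(s in B) signed_coord y s <= ((U :&: B)%SET != finset.set0)%:R.
Proof.
move: y; apply: conv_hull_sub => [x y t /andP[t0 t1]|y].
  move=> /= hx hy; under eq_bigr do rewrite signed_coordD !signed_coordZ.
  rewrite big_split/= -!mulr_sumr.
  set a := \sum_(s in B) _ in hx *; set b := \sum_(s in B) _ in hy *.
  set d := _%:R in hx hy *.
  by nra.
case=> [->|[s sU <-]] /=; first by rewrite big1// => s _; rewrite signed_coord0.
have [sB|sB] := boolP (s \in B).
  have -> : (U :&: B)%SET != finset.set0 by apply/set0Pn; exists s; rewrite inE sB andbT.
  apply: le_trans (ler_sum _ (fun s' _ => signed_coord_evec_le s s')) _.
  by rewrite (bigD1 s)//= eqxx big1 ?addr0// => s' /andP[_]; rewrite eq_sym => /negbTE->.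
apply: le_trans (ler_sum _ (fun s' _ => signed_coord_evec_le s s')) _.
by rewrite big1 ?ler0n// => s' s'B; case: eqP sB => // ->; rewrite s'B.
Qed.

(** The inequalities that cut out the polytope in the orthant of a transversal
    [T], for [B] inside [T]. *)
Lemma minkowski_sum_le_nbrs m (S : 'I_m -> {set signed n}) (B : {set signed n}) x :
  minkowski_sum (fun i => simplex0 R (S i)) x ->
  \sum_(s in B) signed_coord x s <= #|([set: 'I_m] :&: nbrs S B)%SET|%:R.
Proof.
move=> [y yS <-]; under eq_bigr do rewrite signed_coord_sum.
rewrite exchange_big/= finset.setTI -sum1dep_card natr_sum [leRHS]big_mkcond/=.
apply: ler_sum => i _; apply: le_trans (simplex0_sum_le B (yS i)) _.
by case: (_ != _).
Qed.

(** The summands that [phi] assigns to [s] share the coefficient [c s] equally;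
    each share is at most 1, so it stays on the segment from 0 to [evec R s]. *)
Lemma assignment_minkowski_sum m (S : 'I_m -> {set signed n})
    (phi : 'I_m -> option (signed n)) (c : signed n -> R) :
  (forall i s, phi i = Some s -> s \in S i) ->
  (forall s, 0 <= c s <= #|[set i | phi i == Some s]%SET|%:R) ->
  minkowski_sum (fun i => simplex0 R (S i)) (\sum_s c s *: evec R s).
Proof.
move=> phiS cb; pose N s := #|[set i | phi i == Some s]%SET|.
pose y i := if phi i is Some s then (c s / (N s)%:R) *: evec R s else 0.
exists y => [i|].
  rewrite /y; case e: (phi i) => [s|]; last by apply: sub_conv_hull; left.
  apply: conv_hull_scale; first by left.
    by right; exists s => //=; exact: phiS e.
  have /andP[c0 c1] := cb s.
  have N0 : (0 : R) < (N s)%:R.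
    by rewrite ltr0n card_gt0; apply/set0Pn; exists i; rewrite inE e.
  by rewrite divr_ge0 ?ler0n//= ler_pdivrMr// mul1r.
have ey i : y i =
    \sum_s (if phi i == Some s then (c s / (N s)%:R) *: evec R s else 0).
  rewrite /y; case: (phi i) => [s|]; last by rewrite big1.
  rewrite (bigD1 s)//= eqxx big1 ?addr0// => s' s's.
  by case: eqP => // -[e]; rewrite e eqxx in s's.
under eq_bigr do rewrite ey.
rewrite exchange_big; apply: eq_bigr => s _.
rewrite -big_mkcond sumr_const/= -(@eq_card _ [set i | phi i == Some s]%SET);
  last by move=> i; rewrite inE.
rewrite -/(N s) -scaler_nat scalerA; congr (_ *: _).
have := cb s; rewrite -/(N s); case: (N s) => [|N' _].
  by move=> /le_anti <-; rewrite mul0r.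
by rewrite mulrCA mulfV ?mulr1// pnatr_eq0.
Qed.

Lemma cube_bounds q : cube R n q -> forall k, 0 <= q 0 k <= 1.
Proof.
move=> [y yC <-] k; have h i : 0 <= y i 0 k <= (i == k)%:R.
  have /= := yC i; move: (y i); apply: conv_hull_sub => [u v t /andP[t0 t1]|v].
    rewrite /= !mxE => /andP[u0 u1] /andP[v0 v1]; apply/andP; split; first by nra.
    move: u1 v1; set d := _%:R => u1 v1; nra.
  case=> [->|[s]] /=; first by rewrite mxE lexx ler0n.
  by rewrite inE => /eqP -> <- /=; rewrite mxE eqxx /= eq_sym ler0n lexx.
rewrite summxE sumr_ge0/=; last by move=> i _; have /andP[] := h i.
apply: le_trans (_ : \sum_(i < n) (i == k)%:R <= 1).
  by apply: ler_sum => i _; have /andP[] := h i.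
by rewrite (bigD1 k)//= eqxx big1 ?addr0// => i /negbTE->.
Qed.

Lemma cube_corner (q : 'rV[R]_n) :
  (forall k, q 0 k = 0 \/ q 0 k = 1) -> cube R n q.
Proof.
move=> hq; exists (fun i => q 0 i *: delta_mx 0 i) => [i|]; last first.
  by rewrite -row_sum_delta.
apply: conv_hull_scale; first by left.
  by right; exists (inl i) => //=; rewrite inE.
by case: (hq i) => ->; rewrite ?lexx ?ler01.
Qed.

Lemma sum_evec (c : signed n -> R) k :
  (\sum_s c s *: evec R s) 0 k = c (inl k) - c (inr k).
Proof.
have dE (f : 'I_n -> R) : \sum_i f i *: delta_mx 0 i = \row_i f i :> 'rV_n.
  by rewrite [RHS]row_sum_delta; apply: eq_bigr => i _; rewrite mxE.
rewrite big_sumType /= dE; under [in X in _ + X]eq_bigr do rewrite scalerN.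
by rewrite sumrN dE !mxE.
Qed.

End Polytope.

(** * Orthants and draconian sequences *)

(** Each of the [n] pairs meets [T] at most once, so [#|T| = n] forces equality
    in every pair. *)
Lemma AdS_topP n (T : {set signed n}) : (0 < n)%N ->
  reflect (forall k, (inl k \in T) = (inr k \notin T)) (T \in AdS_top n).
Proof.
move=> n0.
have cT : (#|T| = \sum_(k < n) ((inl k \in T) + (inr k \in T)))%N.
  rewrite -sum1_card big_mkcond/= big_sumType/= -big_split/=.
  by apply: eq_bigr => k _; case: (inl k \in T); case: (inr k \in T).
have sum_n : (\sum_(k < n) 1 = n)%N by rewrite sum1_card card_ord.
rewrite inE /admissible; apply: (iffP idP) => [|h].
  case/andP => /andP[_ /forallP adm] /eqP cn k.
  have le1 j : ((inl j \in T) + (inr j \in T) <= 1)%N.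
    by have := adm j; case: (inl j \in T); case: (inr j \in T).
  have lek : (\sum_(j < n | j != k) ((inl j \in T) + (inr j \in T)) <=
      \sum_(j < n | j != k) 1)%N by apply: leq_sum.
  have : ((inl k \in T) + (inr k \in T) = 1)%N.
    apply/eqP; rewrite eqn_leq le1 -(leq_add2r (\sum_(j < n | j != k) 1)).
    rewrite -[X in (X <= _)%N](bigD1 k (P := predT) (F := fun=> 1%N))//= sum_n.
    rewrite -[X in (X <= _)%N]cn cT.
    by rewrite (bigD1 k)//= leq_add2l.
  by case: (inl k \in T); case: (inr k \in T).
have cn : #|T| == n.
  rewrite cT -[X in _ == X]sum_n; apply/eqP/eq_bigr => k _.
  by rewrite h; case: (inr k \in T).
rewrite cn andbT; apply/andP; split; last first.
  by apply/forallP => k; rewrite h andNb.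
by rewrite -card_gt0 (eqP cn).
Qed.

(** The draconian inequalities are Hall's condition seen from the left vertices.
    As the two sides have the same cardinality, it is equivalent to Hall's
    condition from the right: [B] on the right corresponds to the non-neighbours
    of [B] on the left, and [I] on the left to the non-neighbours of [I] on the
    right. *)
Lemma draconian_hall_sets n m (S : 'I_m -> {set signed n}) (T : {set signed n}) :
  #|T| = n ->
  draconian (fun i => (S i :&: T)%SET) `&` le1_seq m =
  (fun J : {set 'I_m} => [ffun i => (i \in J) : nat])
    @` [set` hall_sets S [set: 'I_m]%SET T].
Proof.
move=> cT.
have sumI (J I : {set 'I_m}) : (\sum_(i in I) (i \in J) = #|I :&: J|%SET)%N.
  rewrite -sum1_card [LHS]big_mkcond [RHS]big_mkcond/=; apply: eq_bigr => i _.
  by rewrite inE; case: (i \in I); case: (i \in J).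
have sumT (J : {set 'I_m}) : (\sum_(i < m) (i \in J) = #|J|)%N.
  by rewrite -[in RHS](finset.setTI J) -sumI; apply: eq_bigl => i; rewrite inE.
apply/seteqP; split=> [a [[an aI] a1]|_ [J JH <-]] /=.
  pose J : {set 'I_m} := [set i | a i == 1%N]%SET.
  have aJ : a = [ffun i => (i \in J) : nat].
    apply/ffunP => i; rewrite ffunE inE; have := a1 i.
    by case: (a i) => [|[|]].
  have cJ : #|J| = n.
    by rewrite -sumT -an aJ; apply: eq_bigr => i _; rewrite ffunE.
  exists J => //=; rewrite inE finset.subsetT cJ cT eqxx /=.
  apply/hallP => B BT; rewrite /ones sum1_card.
  have [J0|J0] := eqVneq (J :\: nbrs S B)%SET finset.set0.
    have := cardsID (nbrs S B) J; rewrite J0 cards0 addn0 cJ => ->.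
    by apply: leq_trans (subset_leq_card BT) _; rewrite cT.
  have := aI _ J0; rewrite aJ; under eq_bigr do rewrite ffunE.
  rewrite sumI (finset.setIidPl (finset.subsetDl _ _)).
  set W := (\bigcup_(i in _) _)%SET => JW.
  have : (W \subset T :\: B)%SET.
    apply/bigcupsP => i; rewrite !inE => /andP[/negPn/eqP iB _].
    apply/fintype.subsetP => s; rewrite !inE => /andP[si ->]; rewrite andbT.
    by apply/negP => sB; move/setP/(_ s): iB; rewrite !inE si sB.
  move/subset_leq_card; have := cardsID B T; rewrite (finset.setIidPr BT).
  have := cardsID (nbrs S B) J; rewrite cT cJ => e1 e2 /(leq_trans JW) le.
  by rewrite -(leq_add2r #|T :\: B|%SET) e2 -[X in (X <= _)%N]e1 leq_add2l.
move: JH; rewrite /= inE => /andP[/andP[_ /eqP cJ] /hallP hJ].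
split; last by move=> i; rewrite ffunE; case: (_ \in _).
split=> [|I _]; under eq_bigr do rewrite ffunE.
  by rewrite sumT cJ.
rewrite sumI; set W := (\bigcup_(i in _) _)%SET.
have WT : (W \subset T)%SET by apply/bigcupsP => i _; rewrite finset.subsetIr.
have := hJ _ (finset.subsetDl T W); rewrite /ones sum1_card.
have : (J :&: nbrs S (T :\: W) \subset J :\: I)%SET.
  apply/fintype.subsetP => i; rewrite !inE => /andP[-> /set0Pn[s]].
  rewrite !inE andbT => /and3P[si sW sT]; apply: contra sW => iI.
  by apply/bigcupP; exists i => //; rewrite inE si.
move/subset_leq_card; have := cardsID W T; rewrite (finset.setIidPr WT).
have := cardsID I J; rewrite finset.setIC cJ => <- e2 h1 h2.
by rewrite -(leq_add2r #|J :\: I|%SET) -e2 leq_add2l (leq_trans h2).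
Qed.

Lemma card_draconian n m (S : 'I_m -> {set signed n}) (T : {set signed n}) :
  #|T| = n ->
  #|` fset_set (draconian (fun i => (S i :&: T)%SET) `&` le1_seq m)|
    = #|hall_sets S [set: 'I_m]%SET T|.
Proof.
move=> cT; rewrite draconian_hall_sets//; apply: card_fset_set.
apply: (card_eq_trans _ (card_eq_finset _)).
apply: inj_card_eq => J J' _ _ /ffunP e.
apply/finset.setP => i; have := e i; rewrite !ffunE.
by case: (i \in J); case: (i \in J').
Qed.

(** * Lattice points as demands *)

Section Points.
Variables (R : realType) (n m : nat) (S : 'I_m -> {set signed n}).
Hypothesis n_gt0 : (0 < n)%N.

Local Notation demand := {ffun signed n -> 'I_(#|'I_m|.+2)}.

(** The lowest corner [x] of the unit cube [x + [0, 1]^n] whose corner farthest from the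
    origin has coordinate [w s] along [evec s]: that corner is [x k + 1] in
    direction [k] if [0 <= x k], and [x k] otherwise. *)
Definition demand_point (w : signed n -> nat) : 'rV[R]_n :=
  \row_k (if w (inl k) == 0%N then - (w (inr k))%:R else (w (inl k))%:R - 1).

Definition hall_demands : {set demand} :=
  [set z : demand | (supp z \in AdS_top n)
                    && hall S [set: 'I_m]%SET (wt z) (supp z)]%SET.

Lemma card_hall_demands :
  #|hall_demands| = (\sum_(T in AdS_top n) #|hall_sets S [set: 'I_m]%SET T|)%N.
Proof.
rewrite -sum1dep_card (partition_big (@supp _ _) (mem (AdS_top n))) /=; last first.
  by move=> z /andP[].
apply: eq_bigr => T hT; rewrite sum1dep_card -card_hall_vectors_hall_sets.
apply: eq_card => z; rewrite !inE andbC; case: eqP => //= ->.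
by rewrite inE in hT; rewrite hT.
Qed.

Lemma demand_point_inj :
  {in hall_demands &, injective (fun z : demand => demand_point (wt z))}.
Proof.
move=> z z'; rewrite finset.in_set => /andP[/(elimT (AdS_topP _ n_gt0)) hz _].
rewrite finset.in_set => /andP[/(elimT (AdS_topP _ n_gt0)) hz' _] /rowP e.
have {}e k : wt z (inl k) = wt z' (inl k) /\ wt z (inr k) = wt z' (inr k).
  move: (e k) (hz k) (hz' k); rewrite !inE !mxE.
  case: (wt z (inl k)) => [|a]; case: (wt z' (inl k)) => [|a'] /=.
  - by move=> /oppr_inj/eqP; rewrite eqr_nat => /eqP.
  - rewrite -natr1 addrK => ew /esym/negbFE w0.
    by have := ler0n R a'; rewrite -ew oppr_ge0 lern0 -leqn0 leqNgt w0.
  - rewrite -natr1 addrK => ew _ /esym/negbFE w0.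
    by have := ler0n R a; rewrite ew oppr_ge0 lern0 -leqn0 leqNgt w0.
  - move=> /addIr/eqP; rewrite eqr_nat => /eqP -> /esym + /esym; rewrite -!eqn0Ngt.
    by move=> /eqP -> /eqP ->.
apply/ffunP => -[k|k]; apply: val_inj; [exact: (e k).1|exact: (e k).2].
Qed.

(** If the cube at [x] lies in the polytope, so does its far corner, and the valid
    inequalities of the polytope are Hall's inequalities for that corner.
    Conversely an assignment realising the far corner also realises every point
    of the cube, whose signed coordinates lie between 0 and those of the far
    corner. *)
Lemma minkowski_diff_cube_lattice :
  minkowski_diff (minkowski_sum (fun i => simplex0 R (S i))) (cube R n)
     `&` lattice R n =
  (fun z : demand => demand_point (wt z)) @` [set` hall_demands].
Proof.
apply/seteqP; split=> [x [xP xZ]|_ [z zG <-]].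
  pose a k : int := Num.floor (x 0 k).
  have xa k : x 0 k = (a k)%:~R by rewrite /a floorK.
  pose w (s : signed n) : nat := match s with
    | inl k => if 0 <= a k then `|a k|.+1 else 0%N
    | inr k => if 0 <= a k then 0%N else `|a k|%N end.
  pose T : {set signed n} := [set s | (0 < w s)%N]%SET.
  (* x + q is the far corner. *)
  pose q : 'rV[R]_n := \row_k ((0 <= a k)%R : nat)%:R.
  have TT k : (inl k \in T) = (inr k \notin T).
    by rewrite !inE /=; case: ifP => //; case: (a k).
  have wE s : s \in T -> signed_coord (x + q) s = (w s)%:R.
    case: s => k; rewrite inE /= !mxE xa; case: ifP => // ak _.
      by rewrite -natr1 natr_absz ger0_norm.
    by rewrite addr0 natr_absz ltr0_norm ?rmorphN// ltNge ak.
  have hT : hall S [set: 'I_m]%SET w T.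
    apply/hallP => B BT; rewrite -(ler_nat R) natr_sum.
    rewrite -(eq_bigr _ (fun s sB => wE s (fintype.subsetP BT s sB))).
    apply: minkowski_sum_le_nbrs; apply: xP; exists q => //.
    by apply: cube_corner => k; rewrite mxE; case: (0 <= a k); [right|left].
  have wlt s : (w s < #|'I_m|.+2)%N.
    have [sT|] := boolP (s \in T); last by rewrite inE -eqn0Ngt => /eqP ->.
    have := hallP _ _ _ _ hT [set s]%SET; rewrite finset.sub1set => /(_ sT).
    rewrite finset.big_set1 => h; rewrite ltnS ltnW// ltnS.
    exact: leq_trans h (max_card _).
  pose z : demand := [ffun s => Ordinal (wlt s)].
  have zw s : wt z s = w s by rewrite /wt ffunE.
  have zT : supp z = T by apply/finset.setP => s; rewrite !inE zw.
  exists z => /=.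
    rewrite inE zT; apply/andP; split; first exact/(AdS_topP _ n_gt0).
    by rewrite (@eq_hall _ _ _ _ _ w)// => s _.
  apply/rowP => k; rewrite mxE !zw xa /=.
  case: (boolP (0 <= a k)) => ak /=.
    by rewrite -natr1 addrK natr_absz ger0_norm.
  by rewrite natr_absz ltr0_norm ?rmorphN ?opprK// ltNge ak.
move: zG; rewrite /= inE => /andP[/(elimT (AdS_topP _ n_gt0)) TT hz].
set x := demand_point _; split; last first.
  move=> k; rewrite mxE.
  by case: ifP => _; rewrite ?rpredN ?rpredB ?rpred1 ?natr_int.
move=> _ [q /cube_bounds qb <-].
have [phi [phiS phiN]] := hall_assignment hz.
pose c s := if s \in supp z then signed_coord (x + q) s else 0.
have -> : x + q = \sum_s c s *: evec R s.
  apply/rowP => k; rewrite sum_evec /c TT.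
  by case: (inr k \in supp z); rewrite /= ?subr0// sub0r opprK.
apply: (@assignment_minkowski_sum R n _ S phi c) => [i s e|s].
  by have [] := phiS _ _ e.
rewrite /c; case: ifP => [sT|_]; last by rewrite lexx ler0n.
rewrite phiN//; case: s sT => k sT /=; rewrite !mxE; have /andP[q0 q1] := qb k.
  have w0 : (0 < wt z (inl k))%N by move: sT; rewrite inE.
  have : (1 : R) <= (wt z (inl k))%:R by rewrite ler1n.
  by rewrite gtn_eqF//; lra.
have := TT k; rewrite sT inE /= lt0n => /negbFE ->.
move: sT; rewrite inE => w0.
have : (1 : R) <= (wt z (inr k))%:R by rewrite ler1n.
by lra.
Qed.

End Points.

Theorem theorem4p10 (R : realType) (n m : nat) (hn : (1 <= n)%N)
    (hm : (1 <= m)%N) (S : 'I_m -> {set signed n})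
    (hS : forall i, admissible (S i)) :
  (minkowski_diff (minkowski_sum (fun i => simplex0 R (S i))) (cube R n)
     `&` lattice R n
   #= `I_(\sum_(T in AdS_top n)
            #|` fset_set (draconian (fun i => (S i :&: T)%SET) `&` le1_seq m)|))%card.
Proof.
rewrite minkowski_diff_cube_lattice//.
rewrite (eq_bigr (fun T => #|hall_sets S [set: 'I_m]%SET T|)); last first.
  by move=> T; rewrite inE => /andP[_ /eqP]; exact: card_draconian.
rewrite -card_hall_demands; apply: (card_eq_trans _ (card_eq_finset _)).
apply: inj_card_eq => z z' /set_mem/= zG /set_mem/= z'G.
exact: (demand_point_inj hn zG z'G).
Qed.
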